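(* Let $n\in\mathbb N\cup\{\infty\}$, $\mathcal D\subseteq\mathbb R^n$ nonempty, $T\ge 1$, $s_1,\dots,s_T\in\mathbb R^n$ and $q,k\in\mathbb R^n$ (negative components are allowed), and let $\eta_1\ge\eta_2\ge\dots\ge\eta_T>0$. Assume that all extrema over $\mathcal D$ occurring below (those defining $M(\cdot)$, the minimum and the maximum) are attained. Then $$\sum_{t=1}^T M\Big(s_{1:t}+\frac{k-q}{\eta_t}\Big)\circ s_t\;\le\;\min_{d\in\mathcal D}\Big\{d\circ\Big(s_{1:T}+\frac{k}{\eta_T}\Big)\Big\}+\frac1{\eta_T}\max_{d\in\mathcal D}\{d\circ(q-k)\}-\frac1{\eta_T}M\Big(s_{1:T}+\frac{k}{\eta_T}\Big)\circ q .$$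
   Context: $\circ$ denotes the inner product, $d\circ s=\sum_{i=1}^n d^is^i$; if $n=\infty$, the series $d\circ s_t$, $d\circ k$, $d\circ q$ are assumed absolutely convergent for all $d\in\mathcal D$ and all $t$. $s_{1:t}=s_1+\dots+s_t$. For a vector $s$, $M(s)\in\arg\min_{d\in\mathcal D}\{d\circ s\}$ denotes a (fixed, arbitrarily chosen) minimizer over $\mathcal D$ of $d\mapsto d\circ s$. *)

(* Defs.v *)
From HB Require Import structures.
From mathcomp Require Import all_boot all_order all_algebra.
From mathcomp Require Import all_classical all_reals all_analysis.

Set Implicit Arguments.
Unset Strict Implicit.
Unset Printing Implicit Defensive.

Import Order.TTheory GRing.Theory Num.Theory.
Import numFieldNormedType.Exports.

Local Open Scope classical_set_scope.
Local Open Scope ring_scope.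

(** [vec R n] is R^n, with [n = None] standing for n = oo: the space of all
    real sequences, with no summability built in. *)
Definition vec (R : realType) (n : option nat) : lmodType R :=
  match n with
  | Some m => 'rV[R]_m
  | None => nat -> R^o
  end.

(** For [n = None] the value is meaningful only where the series converges. *)
Definition dot (R : realType) (n : option nat) : vec R n -> vec R n -> R :=
  match n return vec R n -> vec R n -> R with
  | Some m => fun d s : 'rV[R]_m => \sum_(i < m) d 0 i * s 0 i
  | None => fun d s : nat -> R => limn (series (fun i => d i * s i))
  end.

Definition dot_abs_cvg (R : realType) (n : option nat) :
    vec R n -> vec R n -> Prop :=
  match n return vec R n -> vec R n -> Prop with
  | Some m => fun _ _ => True
  | None => fun d s : nat -> R => cvgn [normed series (fun i => d i * s i)]
  end.

Section Extrema.
Variables (R : realType) (n : option nat) (D : set (vec R n)).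

Definition argmin (v : vec R n) : set (vec R n) :=
  [set d | D d /\ forall d', D d' -> dot d v <= dot d' v].

Definition argmax (v : vec R n) : set (vec R n) :=
  [set d | D d /\ forall d', D d' -> dot d' v <= dot d v].

(** The minimum (resp. maximum) of [dot ^~ v] over [D] whenever it is attained,
    i.e. [argmin v] (resp. [argmax v]) is nonempty. *)
Definition min_dot (v : vec R n) : R := inf [set dot d v | d in D].
Definition max_dot (v : vec R n) : R := sup [set dot d v | d in D].

(** [M] picks a minimizer of [dot ^~ v] over [D] for every [v] having one; its
    other values are unconstrained. *)
Definition minimizer_choice (M : vec R n -> vec R n) : Prop :=
  forall v, argmin v !=set0 -> argmin v (M v).

End Extrema.

(** s_{1:t} = s_1 + ... + s_t; [s] is indexed from 1, so [s 0] is unused. *)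
Definition psum (R : realType) (n : option nat) (s : nat -> vec R n) (t : nat) :
    vec R n :=
  \sum_(1 <= i < t.+1) s i.

(* Main.v *)
(** Write [c_t = 1 / eta_t], [z = k - q], [M_t = M (s_{1:t} + c_t z)] and
    [m = max_D (d o (q - k))], so that [d o z + m >= 0] on [D].  Be-the-leader
    with a changing regulariser: by induction on [t],
    [\sum_(i <= t) M_i o s_i <= M_t o (s_{1:t} + c_t z) + c_t m], since passing
    from [M_t] to [M_(t+1)] increases the right-hand side by minimality of [M_t],
    and passing from [c_t] to [c_(t+1) >= c_t] adds
    [(c_(t+1) - c_t) (M_(t+1) o z + m) >= 0].  At [t = T], compare [M_T] with the
    minimizer of [d o (s_{1:T} + c_T k)]. *)

Require Import Defs.
From HB Require Import structures.
From mathcomp Require Import all_boot all_order all_algebra.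
From mathcomp Require Import all_classical all_reals all_analysis.
From mathcomp Require Import zify lra.

Set Implicit Arguments.
Unset Strict Implicit.
Unset Printing Implicit Defensive.

Import Order.TTheory GRing.Theory Num.Theory.
Import numFieldNormedType.Exports.

Local Open Scope classical_set_scope.
Local Open Scope ring_scope.

Section Dot.
Variable R : realType.

(** Plain convergence suffices for the limit laws behind [dotD] and [dotZ], and it passes to sums
    and multiples termwise; absolute convergence enters only through [dot_abs_cvg_cvg]. *)
Definition dot_cvg (n : option nat) (d v : vec R n) : Prop :=
  match n return vec R n -> vec R n -> Prop with
  | Some m => fun _ _ => True
  | None => fun d s : nat -> R => cvgn (series (fun i => d i * s i))
  end d v.

Lemma dot_abs_cvg_cvg n (d v : vec R n) : dot_abs_cvg d v -> dot_cvg d v.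
Proof. by case: n d v => [m|] d v //; exact: normed_cvg. Qed.

Lemma dot_cvgD n (d u v : vec R n) : dot_cvg d u -> dot_cvg d v -> dot_cvg d (u + v).
Proof.
case: n d u v => [m|] d u v //= cu cv; rewrite /dot_cvg.
have -> : (fun i => d i * (u + v) i) =
    (fun i => d i * u i : R) + (fun i => d i * v i : R).
  by apply/funext => i; rewrite /= mulrDr.
exact: is_cvg_seriesD.
Qed.

Lemma dot_cvgZ n (d v : vec R n) (a : R) : dot_cvg d v -> dot_cvg d (a *: v).
Proof.
case: n d v => [m|] d v //= cv; rewrite /dot_cvg.
have -> : (fun i => d i * (a *: v) i) = a *: (fun i => d i * v i : R^o).
  by apply/funext => i; rewrite /= mulrCA.
exact: is_cvg_seriesZ.
Qed.

Lemma dotD n (d u v : vec R n) : dot_cvg d u -> dot_cvg d v ->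
  dot d (u + v) = dot d u + dot d v.
Proof.
case: n d u v => [m|] d u v /= cu cv.
  by rewrite -big_split /=; apply: eq_bigr => i _; rewrite mxE mulrDr.
have -> : (fun i => d i * (u + v) i) =
    (fun i => d i * u i : R) + (fun i => d i * v i : R).
  by apply/funext => i; rewrite /= mulrDr.
exact: lim_seriesD.
Qed.

Lemma dotZ n (d v : vec R n) (a : R) : dot_cvg d v -> dot d (a *: v) = a * dot d v.
Proof.
case: n d v => [m|] d v /= cv.
  by rewrite mulr_sumr; apply: eq_bigr => i _; rewrite mxE mulrCA.
have -> : (fun i => d i * (a *: v) i) = a *: (fun i => d i * v i : R^o).
  by apply/funext => i; rewrite /= mulrCA.
exact: lim_seriesZ.
Qed.

Lemma dot_cvgB n (d u v : vec R n) : dot_cvg d u -> dot_cvg d v -> dot_cvg d (u - v).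
Proof. by move=> cu cv; rewrite -scaleN1r; apply/dot_cvgD/dot_cvgZ. Qed.

Lemma dotB n (d u v : vec R n) : dot_cvg d u -> dot_cvg d v ->
  dot d (u - v) = dot d u - dot d v.
Proof.
move=> cu cv; rewrite -scaleN1r dotD ?dotZ ?mulN1r //; exact: dot_cvgZ.
Qed.

Lemma psumS n (s : nat -> vec R n) t : psum s t.+1 = psum s t + s t.+1.
Proof. by rewrite /psum big_nat_recr. Qed.

Lemma dot_cvg_psum n (d : vec R n) (s : nat -> vec R n) t :
  (forall i, (1 <= i <= t.+1)%N -> dot_cvg d (s i)) -> dot_cvg d (psum s t.+1).
Proof.
elim: t => [|t IH] cs; first by rewrite /psum big_nat1; exact: cs.
rewrite psumS; apply: dot_cvgD; last by apply: cs; rewrite /= leqnn.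
by apply: IH => i /andP[i1 it]; apply: cs; rewrite i1 leqW.
Qed.

Lemma min_dotE n (D : set (vec R n)) (v d : vec R n) : argmin D v d -> min_dot D v = dot d v.
Proof.
move=> [Dd dmin]; apply/eqP; rewrite eq_le; apply/andP; split.
  by apply: ge_inf; [exists (dot d v) => _ [d' Dd' <-]; exact: dmin|exists d].
by apply: lb_le_inf; [exists (dot d v), d|move=> _ [d' Dd' <-]; exact: dmin].
Qed.

(** An attained maximum bounds the set of values above; without a bound, [sup] would be a default
    value. *)
Lemma max_dot_ge n (D : set (vec R n)) (v d : vec R n) :
  argmax D v !=set0 -> D d -> dot d v <= max_dot D v.
Proof.
move=> [d0 [_ d0max]] Dd; apply: ub_le_sup; last by exists d.
by exists (dot d0 v) => _ [d' Dd' <-]; exact: d0max.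
Qed.

End Dot.

Theorem theorem2 (R : realType) (n : option nat) (D : set (vec R n))
    (T : nat) (s : nat -> vec R n) (q k : vec R n) (eta : nat -> R)
    (M : vec R n -> vec R n)
    (D_neq0 : D !=set0)
    (T_ge1 : (1 <= T)%N)
    (eta_noninc : forall t, (1 <= t < T)%N -> eta t.+1 <= eta t)
    (eta_gt0 : 0 < eta T)
    (s_cvg : forall d t, D d -> (1 <= t <= T)%N -> dot_abs_cvg d (s t))
    (k_cvg : forall d, D d -> dot_abs_cvg d k)
    (q_cvg : forall d, D d -> dot_abs_cvg d q)
    (M_argmin : minimizer_choice D M)
    (min_attained_t : forall t, (1 <= t <= T)%N ->
       argmin D (psum s t + (eta t)^-1 *: (k - q)) !=set0)
    (min_attained_T : argmin D (psum s T + (eta T)^-1 *: k) !=set0)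
    (max_attained : argmax D (q - k) !=set0) :
  \sum_(1 <= t < T.+1) dot (M (psum s t + (eta t)^-1 *: (k - q))) (s t)
    <= min_dot D (psum s T + (eta T)^-1 *: k)
       + (eta T)^-1 * max_dot D (q - k)
       - (eta T)^-1 * dot (M (psum s T + (eta T)^-1 *: k)) q.
Proof.
(* Positivity is given at [T] and propagates backwards, by induction on the distance [T - t]; the
   bound [T - t < T] keeps the index at least 1, where [eta_noninc] applies. *)
have etaT t : (1 <= t <= T)%N -> 0 < eta t.
  move=> /andP[t1 tT]; rewrite -(subKn tT).
  have : (T - t < T)%N by lia.
  elim: (T - t)%N => [|j IH] jT; first by rewrite subn0.
  apply: lt_le_trans (IH (ltnW jT)) _.
  have -> : (T - j = (T - j.+1).+1)%N by lia.
  by apply: eta_noninc; lia.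
set z := k - q; set m := max_dot D (q - k).
pose Mt t := M (psum s t + (eta t)^-1 *: z).
have kc d : D d -> dot_cvg d k by move=> Dd; exact/dot_abs_cvg_cvg/k_cvg.
have qc d : D d -> dot_cvg d q by move=> Dd; exact/dot_abs_cvg_cvg/q_cvg.
have zc d : D d -> dot_cvg d z.
  by move=> Dd; apply: dot_cvgB; [exact: kc|exact: qc].
have sc d t : D d -> (1 <= t <= T)%N -> dot_cvg d (s t).
  by move=> Dd tT; apply: dot_abs_cvg_cvg; exact: s_cvg.
have pc d t : D d -> (1 <= t <= T)%N -> dot_cvg d (psum s t).
  case: t => // t Dd tT; apply: dot_cvg_psum => i it.
  by apply: sc => //; lia.
have dotE d t w a : D d -> (1 <= t <= T)%N -> dot_cvg d w ->
    dot d (psum s t + a *: w) = dot d (psum s t) + a * dot d w.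
  by move=> Dd tT cw; rewrite dotD ?dotZ //; [exact: pc|exact: dot_cvgZ].
have zm_ge0 d : D d -> 0 <= dot d z + m.
  move=> Dd; have := max_dot_ge max_attained Dd.
  rewrite -/m /z !dotB; [lra|exact: kc|exact: qc|exact: qc|exact: kc].
have MtP t : (1 <= t <= T)%N -> argmin D (psum s t + (eta t)^-1 *: z) (Mt t).
  by move=> tT; apply: M_argmin; exact: min_attained_t.
have DMt t (tT : (1 <= t <= T)%N) : D (Mt t) := (MtP t tT).1.
(* Indexed by [t.+1] so that the induction starts from one round, where [dot (Mt 1) (s 1)] cancels
   and the slack is [(eta 1)^-1 * (dot (Mt 1) z + m)]. *)
have leader t : (1 <= t.+1 <= T)%N ->
    \sum_(1 <= i < t.+2) dot (Mt i) (s i) <=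
    dot (Mt t.+1) (psum s t.+1 + (eta t.+1)^-1 *: z) + (eta t.+1)^-1 * m.
  elim: t => [|t IH] tT.
    have DM := DMt _ tT.
    rewrite big_nat1 dotE //; last exact: zc.
    rewrite /psum big_nat1 -addrA lerDl -mulrDr mulr_ge0 ?zm_ge0 //.
    by rewrite invr_ge0 ltW ?etaT.
  have tT' : (1 <= t.+1 <= T)%N by lia.
  have DM := DMt _ tT; have DM' := DMt _ tT'.
  rewrite big_nat_recr //=.
  have := IH tT'; have := (MtP _ tT').2 _ DM.
  rewrite !dotE //; try exact: zc.
  rewrite (psumS s t.+1) (dotD (pc _ _ DM tT')); last exact: sc.
  (* The cost of changing the regulariser. Once this product is expanded, the rest is linear in
     monomials such as [(eta t.+2)^-1 * m]. *)
  have : 0 <= ((eta t.+2)^-1 - (eta t.+1)^-1) * (dot (Mt t.+2) z + m).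
    rewrite mulr_ge0 ?zm_ge0 // subr_ge0 lef_pV2 ?posrE ?etaT //.
    by apply: eta_noninc; lia.
  lra.
have TT : (1 <= T <= T)%N by rewrite T_ge1 leqnn.
have dP := M_argmin _ min_attained_T.
(* The minimality of [d] is spent in turning the minimum into a value at [d]; from here only [D d]
   is kept. *)
rewrite (min_dotE dP); move: (M _) dP => d [Dd _].
have := leader T.-1; rewrite prednK // => /(_ TT) le1.
(* Testing [Mt T] against [d] produces the last term of the bound: [dot d z] splits into
   [dot d k - dot d q], and the [k] part completes the minimum. *)
have := (MtP T TT).2 d Dd.
have zE : dot d z = dot d k - dot d q.
  by rewrite dotB; [|exact: kc|exact: qc].
rewrite (dotE d) ?zE //; last exact: zc.
rewrite (dotE d) //; last exact: kc.
move: le1; rewrite /Mt.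
lra.
Qed.
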